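(* Let $\alpha$ be a real number and let $x$ be a rational number which is not an integer. Then the following are equivalent: (i) $x$ is a convergent of $\alpha$; (ii) $C_x$ is a member of the continued fraction chain of $\alpha$; (iii) $x$ is a best approximation of the second kind of $\alpha$; (iv) $C_x$ is nearby to $\alpha$; (v) there is a Ford circle $C_y$ tangent to $C_x$ such that $\mathrm{rad}[C_x] > \mathrm{rad}[C_y]$, and either $\alpha = x$ or $\alpha$ lies in the open interval bounded by $x$ and $y$.
   Context: A rational $u/v$ always means $u,v$ coprime integers with $v>0$. Given a real $\alpha$, a rational $a/b$ is a best approximation of the second kind of $\alpha$ if for every rational $c/d$ with $d\le b$ we have $|b\alpha-a|\le|d\alpha-c|$, with equality if and only if $c/d=a/b$. A continued fraction is an expression $b_0+\cfrac{1}{b_1+\cfrac{1}{b_2+\cdots}}$ with $b_0\in\mathbb{Z}$ and $b_i$ positive integers for $i\ge1$, either infinite or finite with last term $b_N$; finite continued fractions with $N\ge1$ are required to have $b_N\ge2$. Its convergents are $A_0/B_0=b_0$, $A_1/B_1=b_0+1/b_1$, $A_2/B_2=b_0+\frac{1}{b_1+\frac{1}{b_2}}$, etc. (in lowest terms, positive denominators). Every real $\alpha$ has a unique such continued fraction whose value (last convergent if finite, limit of convergents if infinite) is $\alpha$; the convergents of $\alpha$ are the convergents of this continued fraction. The Ford circle $C_x$ of a rational $x=a/b$ is the circle in the complex plane with centre $x+i/(2b^2)$ and radius $1/(2b^2)$; $\mathrm{rad}[C]$ denotes the radius of a circle $C$. The continued fraction chain of $\alpha$ is the sequence of Ford circles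 $C_{A_0/B_0},C_{A_1/B_1},C_{A_2/B_2},\dots$ where $A_n/B_n$ are the convergents of $\alpha$. A horocircle is a circle tangent to the real axis at a point $z$ (its base point) and otherwise lying in the open upper half-plane. Given a real $z$ and a horocircle $C$, there is a unique horocircle with base point $z$ tangent to $C$; if $C$ itself has base point $z$, this horocircle is considered to have radius $0$. A Ford circle $C_x$ is nearby to a real number $\alpha$ if for every Ford circle $C_z\ne C_x$ with $\mathrm{rad}[C_z]\ge\mathrm{rad}[C_x]$, the radius of the unique horocircle with base point $\alpha$ tangent to $C_z$ is strictly larger than the radius of the unique horocircle with base point $\alpha$ tangent to $C_x$. *)

(* Defs.v *)
From HB Require Import structures.
From mathcomp Require Import all_boot all_order all_algebra.
From mathcomp Require Import all_classical all_reals all_analysis.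
From mathcomp Require Import complex.
From mathcomp Require Import ring lra.

Set Implicit Arguments.
Unset Strict Implicit.
Unset Printing Implicit Defensive.

Import Order.TTheory GRing.Theory Num.Theory.
Import numFieldNormedType.Exports.

Local Open Scope classical_set_scope.
Local Open Scope ring_scope.
Local Open Scope complex_scope.

Section BestApproximation.
Context {R : realType}.

Definition second_kind_err (alpha : R) (x : rat) : R :=
  `| (denq x)%:~R * alpha - (numq x)%:~R |.

Definition best_approx2 (alpha : R) (x : rat) : Prop :=
  forall y : rat, denq y <= denq x ->
    second_kind_err alpha x <= second_kind_err alpha y
    /\ (second_kind_err alpha x = second_kind_err alpha y <-> y = x).

End BestApproximation.

Section ContinuedFractions.

(* [CFfin b0 [:: b1; ...; bN]] is the finite continued fraction with terms
   b0, b1, ..., bN; in [CFinf b0 b] the term of index i >= 1 is [b i.-1]. *)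
Inductive cfrac : Type :=
  | CFfin of int & seq nat
  | CFinf of int & (nat -> nat).

Definition cf_wf (c : cfrac) : Prop :=
  match c with
  | CFfin _ s => all (fun b => 0 < b)%N s /\ (s <> [::] -> (2 <= last 0 s)%N)
  | CFinf _ b => forall i, (0 < b i)%N
  end.

(* 1 / (b1 + 1 / (b2 + ...)), and 0 for the empty list of terms. *)
Fixpoint cf_frac_part (s : seq nat) : rat :=
  if s is b :: s' then (b%:R + cf_frac_part s')^-1 else 0.

Definition cf_eval (b0 : int) (s : seq nat) : rat := b0%:~R + cf_frac_part s.

Definition cf_has_index (c : cfrac) (n : nat) : Prop :=
  if c is CFfin _ s then (n <= size s)%N else True.

(* Meaningful only when [cf_has_index c n]. *)
Definition cf_convergent (c : cfrac) (n : nat) : rat :=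
  match c with
  | CFfin b0 s => cf_eval b0 (take n s)
  | CFinf b0 b => cf_eval b0 (mkseq b n)
  end.

Context {R : realType}.

Definition cf_value (c : cfrac) (alpha : R) : Prop :=
  match c with
  | CFfin _ s => ratr (cf_convergent c (size s)) = alpha
  | CFinf _ _ => (ratr (cf_convergent c n) : R) @[n --> \oo] --> alpha
  end.

Definition cf_of (alpha : R) (c : cfrac) : Prop := cf_wf c /\ cf_value c alpha.

Definition is_convergent (alpha : R) (x : rat) : Prop :=
  exists c : cfrac, cf_of alpha c /\
    exists2 n : nat, cf_has_index c n & x = cf_convergent c n.

End ContinuedFractions.

Section Circles.
Context {R : realType}.

Record circle : Type := Circle {
  circle_centre : R[i];
  circle_rad : R;
  circle_rad_gt0 : 0 < circle_rad }.

Definition points (C : circle) : set R[i] :=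
  [set p | `|p - circle_centre C| = (circle_rad C)%:C].

Definition tangent (C D : circle) : Prop :=
  exists! p : R[i], (points C `&` points D) p.

(* [C] meets the real axis exactly at [z], and otherwise lies in the open upper
   half-plane. *)
Definition horocircle (C : circle) (z : R) : Prop :=
  points C z%:C /\ forall p, points C p -> p <> z%:C -> 0 < complex.Im p.

Definition tangent_horocircle_radii (z : R) (C : circle) : set R :=
  [set r | exists D, [/\ horocircle D z, tangent D C & circle_rad D = r]].

(* [tangent_horocircle_radii] is a singleton when [C] is a horocircle whose base
   point is not [z]: see [tangent_horocircle_unique]. *)
Definition tangent_horocircle_radius (z : R) (C : circle) : R :=
  if `[< horocircle C z >] then 0 else xget 0 (tangent_horocircle_radii z C).

Definition ford_radius (x : rat) : R := (2 * (denq x)%:~R ^+ 2)^-1.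

Lemma ford_radius_gt0 (x : rat) : 0 < ford_radius x.
Proof. by rewrite invr_gt0 mulr_gt0 // exprn_gt0 // ltr0z denq_gt0. Qed.

Definition ford_circle (x : rat) : circle :=
  Circle (ratr x +i* ford_radius x) (ford_radius_gt0 x).

Definition in_cf_chain (alpha : R) (C : circle) : Prop :=
  exists c : cfrac, cf_of alpha c /\
    exists2 n : nat, cf_has_index c n & C = ford_circle (cf_convergent c n).

Definition nearby (x : rat) (alpha : R) : Prop :=
  forall z : rat, ford_circle z <> ford_circle x ->
    circle_rad (ford_circle x) <= circle_rad (ford_circle z) ->
    tangent_horocircle_radius alpha (ford_circle x)
      < tangent_horocircle_radius alpha (ford_circle z).

Lemma pointsE (C : circle) (p : R[i]) :
  points C p <->
  (complex.Re p - complex.Re (circle_centre C)) ^+ 2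
    + (complex.Im p - complex.Im (circle_centre C)) ^+ 2 = circle_rad C ^+ 2.
Proof.
rewrite /points/= normc_def; case: C p => -[a b] r r0 [u v] /=.
split=> [[] <-|->]; first by rewrite sqr_sqrtr// addr_ge0// sqr_ge0.
by rewrite sqrtr_sqr ger0_norm// ltW.
Qed.

Lemma horocircleE (C : circle) (z : R) :
  horocircle C z <-> circle_centre C = z +i* circle_rad C.
Proof.
split=> [[]|].
- move=> /pointsE; case: C => -[a b] r r0 /= h H.
  have lowP : points (Circle (a +i* b) r0) (a +i* (b - r)).
    by apply/pointsE => /=; ring.
  have [[-> h2]|low_neq] := pselect (a +i* (b - r) = z%:C :> R[i]).
    by rewrite -(subr0_eq h2).
  have /= br := H _ lowP low_neq; exfalso.
  have : 0 < (b - r) * (b - r + 2 * r) by rewrite mulr_gt0// addr_gt0// mulr_gt0.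
  by have := sqr_ge0 (z - a); lra.
- case: C => -[a b] r r0 /= [-> ->]; split.
    by apply/pointsE => /=; ring.
  move=> [u v] /pointsE /= h neq; rewrite ltNge; apply/negP => v0.
  have rv : 0 <= - (v * r) by rewrite -mulNr mulr_ge0 ?oppr_ge0// ltW.
  have sq1 := sqr_ge0 (u - z); have sq2 := sqr_ge0 v.
  have /eqP : (u - z) ^+ 2 = 0 by nra.
  have /eqP : v ^+ 2 = 0 by nra.
  rewrite !sqrf_eq0 subr_eq0 => /eqP v00 /eqP uz.
  by apply: neq; rewrite uz v00.
Qed.

Lemma tangent_horocirclesE (C D : circle) (z w : R) :
  horocircle C z -> horocircle D w -> z != w ->
  tangent C D <-> (z - w) ^+ 2 = 4 * circle_rad C * circle_rad D.
Proof.
move=> /horocircleE + /horocircleE.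
case: C D => cC r r0 [cD s s0] /= -> -> zw.
have u0 : 0 < (z - w) ^+ 2 by rewrite lt0r sqr_ge0 andbT sqrf_eq0 subr_eq0.
pose d2 := (w - z) ^+ 2 + (s - r) ^+ 2.
have d20 : 0 < d2 by rewrite /d2; have := sqr_ge0 (s - r); nra.
split.
- move=> [[a b] [[/pointsE /= h1 /pointsE /= h2] uniq_p]].
  pose k := 2 * ((w - z) * (b - r) - (s - r) * (a - z)) / d2.
  have kE : k * d2 = 2 * ((w - z) * (b - r) - (s - r) * (a - z)).
    by rewrite /k divfK // gt_eqF.
  have refl : (a +i* b : R[i]) = (a + k * (s - r)) +i* (b - k * (w - z)).
    apply: uniq_p; split; apply/pointsE => /=.
      rewrite -h1; apply/eqP; rewrite -subr_eq0.
      suff -> : (a + k * (s - r) - z) ^+ 2 + (b - k * (w - z) - r) ^+ 2 -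
        ((a - z) ^+ 2 + (b - r) ^+ 2) =
        k * (k * d2 - 2 * ((w - z) * (b - r) - (s - r) * (a - z))).
        by rewrite kE subrr mulr0.
      by rewrite /d2; ring.
    rewrite -h2; apply/eqP; rewrite -subr_eq0.
    suff -> : (a + k * (s - r) - w) ^+ 2 + (b - k * (w - z) - s) ^+ 2 -
        ((a - w) ^+ 2 + (b - s) ^+ 2) =
        k * (k * d2 - 2 * ((w - z) * (b - r) - (s - r) * (a - z))).
      by rewrite kE subrr mulr0.
    by rewrite /d2; ring.
  case: refl => _ hb.
  have kw : k * (w - z) = 0 by lra.
  have k0 : k = 0.
    by move/eqP: kw; rewrite mulf_eq0 subr_eq0 [w == z]eq_sym (negbTE zw) orbF
      => /eqP.
  have cross : (w - z) * (b - r) - (s - r) * (a - z) = 0.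
    by move: kE; rewrite k0 mul0r; lra.
  have dot : 2 * ((a - z) * (w - z) + (b - r) * (s - r))
      = d2 + r ^+ 2 - s ^+ 2 by rewrite -h1 -h2 /d2; ring.
  have : (d2 + r ^+ 2 - s ^+ 2) ^+ 2 = 4 * r ^+ 2 * d2.
    have -> : 4 * r ^+ 2 * d2 = (2 * ((a - z) * (w - z) + (b - r) * (s - r))) ^+ 2
      + 4 * ((w - z) * (b - r) - (s - r) * (a - z)) ^+ 2.
      by rewrite -{1}h1 /d2; ring.
    by rewrite cross -dot; ring.
  move=> e.
  have /eqP : (z - w) ^+ 2 * ((z - w) ^+ 2 - 4 * r * s) = 0.
    have -> : (z - w) ^+ 2 * ((z - w) ^+ 2 - 4 * r * s) =
      (d2 + r ^+ 2 - s ^+ 2) ^+ 2 - 4 * r ^+ 2 * d2 by rewrite /d2; ring.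
    by rewrite e subrr.
  by rewrite mulf_eq0 gt_eqF//= subr_eq0 => /eqP.
- move=> e.
  have rs0 : r + s != 0 by rewrite gt_eqF// addr_gt0.
  pose t := r / (r + s).
  have tE : t * (r + s) = r by rewrite /t divfK.
  have d2E : d2 = (r + s) ^+ 2 by rewrite /d2 -sqrrN opprB e; ring.
  have t1 : t ^+ 2 * d2 = r ^+ 2 by rewrite d2E -exprMn tE.
  have t2 : (1 - t) ^+ 2 * d2 = s ^+ 2.
    by rewrite d2E -exprMn mulrBl tE; ring.
  exists ((z + t * (w - z)) +i* (r + t * (s - r))); split.
    split; apply/pointsE => /=.
      by rewrite -t1 /d2; ring.
    by rewrite -t2 /d2; ring.
  move=> [a b] [/pointsE /= h1 /pointsE /= h2].
  have dot : 2 * ((a - z) * (w - z) + (b - r) * (s - r))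
      = d2 + r ^+ 2 - s ^+ 2 by rewrite -h1 -h2 /d2; ring.
  have E : (a - (z + t * (w - z))) ^+ 2 + (b - (r + t * (s - r))) ^+ 2 = 0.
    have -> : (a - (z + t * (w - z))) ^+ 2 + (b - (r + t * (s - r))) ^+ 2 =
      ((a - z) ^+ 2 + (b - r) ^+ 2) + t ^+ 2 * d2
      - t * (2 * ((a - z) * (w - z) + (b - r) * (s - r))) by rewrite /d2; ring.
    rewrite h1 t1 dot d2E.
    have -> : (r + s) ^+ 2 + r ^+ 2 - s ^+ 2 = 2 * r * (r + s) by ring.
    by rewrite mulrCA tE; ring.
  move/eqP: E; rewrite paddr_eq0 ?sqr_ge0// !sqrf_eq0 !subr_eq0.
  by move=> /andP[/eqP -> /eqP ->].
Qed.

Lemma tangent_horocircle_unique (z w : R) (C : circle) :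
  horocircle C w -> z != w ->
  tangent_horocircle_radii z C = [set (z - w) ^+ 2 / (4 * circle_rad C)].
Proof.
move=> hC zw; have r0 := circle_rad_gt0 C.
have u0 : 0 < (z - w) ^+ 2 by rewrite lt0r sqr_ge0 andbT sqrf_eq0 subr_eq0.
apply/seteqP; split=> [_ [D [hD tD <-]]|_ ->] /=.
  have -> := (tangent_horocirclesE hD hC zw).1 tD.
  by field; rewrite gt_eqF.
have q0 : 0 < (z - w) ^+ 2 / (4 * circle_rad C).
  by rewrite divr_gt0// mulr_gt0.
pose D := Circle (z +i* ((z - w) ^+ 2 / (4 * circle_rad C))) q0.
have hD : horocircle D z by apply/horocircleE.
exists D; split => //; apply/(tangent_horocirclesE hD hC zw).
by rewrite /=; field; rewrite gt_eqF.
Qed.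

End Circles.
Arguments circle : clear implicits.

(* Main.v *)
Require Import Defs.
From HB Require Import structures.
From mathcomp Require Import all_boot all_order all_algebra.
From mathcomp Require Import all_classical all_reals all_analysis.
From mathcomp Require Import complex.
From mathcomp Require Import ring lra zify.

(* All conditions are compared with one arithmetic fact: x = a/b has a Farey
   neighbour c/d of larger denominator (cb - ad = +-1) such that alpha is x or
   lies strictly between x and c/d. A convergent A/B with predecessor A'/B' has
   such a neighbour, namely (A + A')/(B + B'), and conversely the fact passes
   from (alpha, x) to (1/(alpha - m), 1/(x - m)), m the integer part, which
   lowers the denominator of x and so builds the continued fraction. Writing
   (p, q) in the basis (a, b), (c, d) of Z^2 shows that x is a best
   approximation; conversely, adding to a/b the neighbour of smaller
   denominator on the side of alpha yields c/d. Finally, the horocircle at alpha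
   tangent to C_x has radius (b alpha - a)^2 / 2, so "nearby" is a restatement
   of "best approximation". *)

Import Order.TTheory GRing.Theory Num.Theory.
Import numFieldNormedType.Exports.

Local Open Scope classical_set_scope.
Local Open Scope ring_scope.

(** * Continued fractions: bounds, tails, and adding a first term *)

Lemma cf_frac_part_itv s : all (fun b => 0 < b)%N s -> 0 <= cf_frac_part s <= 1.
Proof.
elim: s => [//|b s IH] /= /andP[b0 /IH /andP[h0 h1]].
have : 1 <= b%:R + cf_frac_part s.
  have : 1 <= b%:R :> rat by rewrite ler1n.
  by move: h0; lra.
by move=> h; rewrite invr_ge0 invf_le1; lra.
Qed.

Lemma cf_eval_cons b0 b s :
  cf_eval b0 (b :: s) = b0%:~R + (cf_eval (b : nat) s)^-1.
Proof. by []. Qed.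

(** The upper bound is attained: a truncation may end in a term 1. *)
Lemma cf_eval_itv b s : all (fun b => 0 < b)%N s ->
  b%:~R <= cf_eval b s <= b%:~R + 1.
Proof. by move=> /cf_frac_part_itv; rewrite /cf_eval; lra. Qed.

Section FordCircles.
Context {R : realType}.
Implicit Types (alpha : R).

Lemma ratr_cf_eval_cons b0 b s : ratr (cf_eval b0 (b :: s)) =
  b0%:~R + (ratr (cf_eval (b : nat) s))^-1 :> R.
Proof. by rewrite cf_eval_cons rmorphD/= fmorphV/= ratr_int. Qed.

Lemma ratr_cf_eval_itv b s : all (fun b => 0 < b)%N s ->
  b%:~R <= (ratr (cf_eval b s) : R) <= b%:~R + 1.
Proof.
move=> /(cf_eval_itv b)/andP[]; rewrite -!(ler_rat R).
rewrite (rmorphD _ b%:~R 1) rmorph1 /= ratr_int.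
by move=> -> ->.
Qed.

(** The tail value t exceeds 1, so 1/t < 1: either t is the last term, which is at least 2, or by
    induction t exceeds its own head b >= 1. *)
Lemma cf_fin_tail alpha b0 b s : cf_of alpha (CFfin b0 (b :: s)) ->
  0 < alpha - b0%:~R < 1 /\ cf_of (alpha - b0%:~R)^-1 (CFfin (b : nat) s).
Proof.
elim: s b0 b alpha => [|b' s IH] b0 b alpha [] [] /andP[b_gt0 all_s] last_s.
  have b2 : (2 <= b)%N by apply: last_s.
  rewrite /= => <-.
  rewrite ratr_cf_eval_cons addrAC subrr add0r.
  have b2R : 2 <= b%:R :> R by rewrite ler_nat.
  rewrite /cf_eval/= addr0 ratr_int invrK; split.
    by rewrite invr_gt0 invf_lt1 -pmulrn; lra.
  by split => //=; rewrite /cf_eval addr0 ratr_int.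
rewrite [cf_value _ _]/= !take_size.
rewrite ratr_cf_eval_cons => <-; rewrite addrAC subrr add0r invrK.
set t := ratr _.
have ct : cf_of t (CFfin b (b' :: s)).
  split; last by rewrite /= take_size.
  by split=> // _; exact: last_s.
have [/andP[t0 _] _] := IH _ _ _ ct.
have b1R : 1 <= b%:R :> R by rewrite ler1n.
by split=> //; rewrite invr_gt0 invf_lt1; move: t0; rewrite -pmulrn; lra.
Qed.

Lemma cf_inf_convS b0 b n : cf_convergent (CFinf b0 b) n.+1 =
  cf_eval b0 (b 0%N :: mkseq (b \o S) n).
Proof. by rewrite /= /mkseq /= -[1%N]addn0 iotaDl -map_comp. Qed.

Lemma cf_inf_tail_cvg alpha b0 b : alpha != b0%:~R ->
  cf_of alpha (CFinf b0 b) ->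
  cf_of (alpha - b0%:~R)^-1 (CFinf (b 0%N) (b \o S)).
Proof.
move=> ne [/= bpos]; rewrite -cvg_shiftS => cv.
split=> [i|/=]; first exact: bpos.
have ne0 : alpha - b0%:~R != 0 by rewrite subr_eq0.
rewrite (_ : (fun n => _) =
    (fun n => (ratr (cf_convergent (CFinf b0 b) n.+1) - b0%:~R)^-1)).
  by apply: cvgV => //; apply: cvgB => //; exact: cvg_cst.
apply/funext => n; rewrite cf_inf_convS ratr_cf_eval_cons.
by rewrite addrAC subrr add0r invrK.
Qed.

(** A limit of strict inequalities is only weak, hence a uniform gap: tails are at most b1 + 1, so
    every convergent of index at least 1 is at least b0 + 1/(b1 + 1). *)
Lemma cf_inf_gt alpha b0 b : cf_of alpha (CFinf b0 b) -> b0%:~R < alpha.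
Proof.
move=> [/= bpos]; rewrite -cvg_shiftS => cv.
apply: (@lt_le_trans _ _ (b0%:~R + ((b 0%N)%:R + 1)^-1)).
  by rewrite ltrDl invr_gt0 ltr_wpDl.
rewrite -(cvg_lim _ cv) //; apply: limr_ge; first exact: cvgP cv.
apply: nearW => n.
rewrite -[leRHS]/(ratr (cf_convergent (CFinf b0 b) n.+1)) cf_inf_convS.
rewrite ratr_cf_eval_cons lerD2l.
have /(ratr_cf_eval_itv (b 0%N))/andP[h1 h2] :
  all (fun b => 0 < b)%N (mkseq (b \o S) n).
  by apply/allP => _ /mapP[i _ ->]; exact: bpos.
have b1 : 0 < (b 0%N)%:R :> R by rewrite ltr0n.
move: h1 h2; rewrite -pmulrn => h1 h2.
by rewrite lef_pV2 ?posrE; lra.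
Qed.

(** The upper bound comes from [cf_inf_gt] applied to the tail, whose value exceeds b1 >= 1. *)
Lemma cf_inf_tail alpha b0 b : cf_of alpha (CFinf b0 b) ->
  0 < alpha - b0%:~R < 1 /\
  cf_of (alpha - b0%:~R)^-1 (CFinf (b 0%N) (b \o S)).
Proof.
move=> c; have gt := cf_inf_gt _ _ _ c; have ne := negbT (gt_eqF gt).
have ct := cf_inf_tail_cvg _ _ _ ne c; split=> //; rewrite subr_gt0 gt /=.
have := cf_inf_gt _ _ _ ct.
have b1 : 1 <= (b 0%N)%:R :> R by rewrite ler1n; have [+ _] := c; apply.
rewrite -pmulrn => /(le_lt_trans b1).
by rewrite invf_gt1 // subr_gt0.
Qed.

(** Converse of the two tail lemmas. The head of [c] has to become a positive natural number: t > 1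
    exceeds it by less than 1 or equals it, and in the latter case it is a last term, which t > 1
    makes at least 2. *)
Lemma cf_cons alpha (b0 : int) c : 0 < alpha - b0%:~R < 1 ->
  cf_of (alpha - b0%:~R)^-1 c ->
  exists c', [/\ cf_of alpha c', cf_convergent c' 0 = b0%:~R &
    forall n, cf_has_index c n -> cf_has_index c' n.+1 /\
      cf_convergent c' n.+1 = b0%:~R + (cf_convergent c n)^-1].
Proof.
move=> /andP[a0 a1]; set t := _^-1.
have t1 : 1 < t by rewrite invf_gt1.
have aE : alpha = b0%:~R + t^-1 by rewrite invrK addrC subrK.
have pos (m : int) : 0 < t - m%:~R < 1 -> exists2 b : nat, m = b & (0 < b)%N.
  move=> /andP[_ tm]; have : 0 < m%:~R :> R by lra.
  by rewrite ltr0z; case: m {tm} => // b b_gt0; exists b.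
case: c => [m s|m b] ct.
- have [b mb [b_gt0 b2]] : exists2 b : nat, m = b &
      (0 < b)%N /\ (s = [::] -> (2 <= b)%N).
    case: s ct => [|b' s] ct; last first.
      by have [/pos[b -> b_gt0] _] := cf_fin_tail _ _ _ _ ct; exists b.
    have [_] := ct; rewrite /= /cf_eval addr0 ratr_int => tE.
    have : 1 < m%:~R :> R by rewrite tE.
    rewrite (_ : 1 = 1%:~R) // ltr_int; case: m {ct tE} => // b b1.
    by exists b => //; split=> [|_]; exact: (leq_trans _ b1).
  move: ct; rewrite {}mb => -[[s_pos last_s] ct].
  exists (CFfin b0 (b :: s)); split=> //.
  + split.
      split; first by rewrite /= b_gt0.
      case: s b2 {s_pos ct} last_s => //= [|? ?] b2 ls _; first exact: b2.
      exact: ls.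
    by move: ct; rewrite /= !take_size ratr_cf_eval_cons aE => ->.
  + by rewrite /= /cf_eval addr0.
- have [/pos[k mk k_gt0] _] := cf_inf_tail _ _ _ ct.
  move: ct; rewrite {}mk => -[/= b_pos ct].
  pose b' i := if i is j.+1 then b j else k.
  have convS n : cf_convergent (CFinf b0 b') n.+1 = cf_eval b0 (k :: mkseq b n).
    by rewrite cf_inf_convS.
  exists (CFinf b0 b'); split=> //.
  + split; first by case.
    rewrite /= -cvg_shiftS.
    rewrite (_ : (fun n => _) =
        (fun n => b0%:~R + (ratr (cf_eval k (mkseq b n)))^-1)).
      rewrite aE; apply: cvgD; first exact: cvg_cst.
      by apply: cvgV => //; rewrite gt_eqF //; lra.
    by apply/funext => n; rewrite -ratr_cf_eval_cons -convS.
  + by rewrite /= /cf_eval addr0.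
Qed.

(** * Existence of the expansion, by iterating the Gauss map *)

Lemma fract_itv alpha : alpha \isn't a Num.int ->
  0 < alpha - (Num.floor alpha)%:~R < 1.
Proof.
rewrite intrEfloor => ne; have /andP[h1 h2] := floor_itv alpha.
by rewrite subr_gt0 lt_neqAle ne h1 ltrBlDl -[1](_ : 1%:~R = _) // -intrD.
Qed.

(** Sends a complete quotient to the next one, and an integer to 0. *)
Definition gauss alpha : R := (alpha - (Num.floor alpha)%:~R)^-1.

Lemma gauss_gt1 alpha : alpha \isn't a Num.int -> 1 < gauss alpha.
Proof. by move=> /fract_itv/andP[h0 h1]; rewrite invf_gt1. Qed.

Lemma floor_gauss_gt0 {alpha} : alpha \isn't a Num.int ->
  (0 < `|Num.floor (gauss alpha)|)%N.
Proof.
move=> /gauss_gt1 h; rewrite absz_gt0 gt_eqF //.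
by rewrite (lt_le_trans ltr01) // floor_ge_int ltW.
Qed.

(* For 1 <= u <= v = u + d one has 1/u - 1/v = d/(uv) <= d/(1 + d), and
   d <= 1/(n+1) gives d/(1 + d) <= 1/(n+2). *)
Lemma dist_inv_le (u v : R) n : 1 <= u -> 1 <= v -> `|u - v| <= n.+1%:R^-1 ->
  `|u^-1 - v^-1| <= n.+2%:R^-1.
Proof.
wlog uv : u v / u <= v => [W u1 v1|u1 v1].
  have [uv|/ltW vu] := leP u v; first exact: W _ _ uv u1 v1.
  by rewrite distrC (distrC u^-1); exact: W _ _ vu v1 u1.
rewrite ler0_norm ?subr_le0 // ger0_norm ?subr_ge0 ?lef_pV2 ?posrE//; try lra.
rewrite opprB -[n.+2%:R]natr1; set k := n.+1%:R => h.
have k0 : 0 < k by rewrite ltr0n.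
have dk : (v - u) * k <= 1 by rewrite -ler_pdivlMr // div1r.
have -> : u^-1 - v^-1 = (v - u) / (u * v) by field; rewrite !gt_eqF; lra.
rewrite ler_pdivrMr ?mulr_gt0; try lra.
rewrite mulrC ler_pdivlMr; last lra.
have : 0 <= (u - 1) * v by rewrite mulr_ge0; lra.
by nra.
Qed.

Definition gauss_cf alpha : cfrac :=
  CFinf (Num.floor alpha) (fun i => `|Num.floor (iter i.+1 gauss alpha)|%N).

(** The heads agree, and [dist_inv_le] carries the bound from the tails, both at least 1. The rate
    is crude but enough for a squeeze by the harmonic sequence. *)
Lemma gauss_cf_dist alpha n : (forall i, iter i gauss alpha \isn't a Num.int) ->
  `|alpha - ratr (cf_convergent (gauss_cf alpha) n)| <= n.+1%:R^-1.
Proof.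
elim: n alpha => [|n IH] alpha irr.
  rewrite /= /cf_eval addr0 ratr_int invr1.
  by have /andP[h0 h1] := fract_itv _ (irr 0); rewrite gtr0_norm // ltW.
have irr' i : iter i gauss (gauss alpha) \isn't a Num.int.
  by rewrite -iterSr; exact: irr.
rewrite cf_inf_convS ratr_cf_eval_cons.
set s := mkseq _ _.
have -> : ratr (cf_eval `|Num.floor (iter 1 gauss alpha)|%N s) =
    ratr (cf_convergent (gauss_cf (gauss alpha)) n) :> R.
  congr (ratr (cf_eval _ _)).
    apply: gez0_abs; rewrite floor_ge0.
    exact/ltW/(lt_trans ltr01)/gauss_gt1/(irr 0).
  by rewrite /s /mkseq; apply: eq_map => i /=; rewrite -iterSr.
rewrite opprD addrA -[X in `|X - _|]invrK; apply: dist_inv_le.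
- exact/ltW/gauss_gt1/(irr 0).
- have [|+ _] := andP (ratr_cf_eval_itv (Num.floor (gauss alpha))
    (mkseq (fun i => `|Num.floor (iter i.+1 gauss (gauss alpha))|%N) n) _).
    by apply/allP => _ /mapP[i _ ->]; exact: floor_gauss_gt0 (irr' i).
  apply: le_trans; rewrite -[1](_ : 1%:~R = _) // ler_int floor_ge_int.
  exact/ltW/gauss_gt1/(irr 0).
- exact: IH.
Qed.

(** Either some complete quotient is an integer and the fraction is built backwards from it, or
    [gauss_cf] converges to alpha. The head is recorded in order to make the floor a convergent. *)
Lemma cf_of_floor alpha : exists c,
  cf_of alpha c /\ cf_convergent c 0 = (Num.floor alpha)%:~R.
Proof.
have int_case (z : R) : z \is a Num.int ->
    exists c, cf_of z c /\ cf_convergent c 0 = (Num.floor z)%:~R.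
  move=> zi; exists (CFfin (Num.floor z) [::]).
  rewrite /= /cf_eval addr0; split=> //.
  by split=> //=; rewrite /cf_eval addr0 ratr_int floorK.
have [[n]|irr] := pselect (exists n, iter n gauss alpha \is a Num.int).
  elim: n alpha => [|n IH] alpha; rewrite ?iterSr /= => h.
    exact: int_case.
  (* The integer iterate at hand need not be the first one. *)
  have [ai|ai] := boolP (alpha \is a Num.int).
    exact: int_case.
  have [c [cf _]] := IH _ h.
  by have [c' [? ? _]] := cf_cons _ _ _ (fract_itv _ ai) cf; exists c'.
have {}irr i : iter i gauss alpha \isn't a Num.int.
  by apply/negP => ?; apply: irr; exists i.
exists (gauss_cf alpha); split; last by rewrite /= /cf_eval addr0.
split; first by move=> i; exact: floor_gauss_gt0 (irr i).
have har := @cvg_harmonic R.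
rewrite /cf_value; apply: (@squeeze_cvgr _ _ _ _ (fun n => alpha - harmonic n)
    (fun n => alpha + harmonic n)).
- apply: nearW => n.
  have := gauss_cf_dist alpha n irr; rewrite ler_norml => /andP[h1 h2].
  rewrite lerBlDr -lerBlDl h2 /=.
  by rewrite -lerBlDl -opprB lerNl.
- have : alpha - harmonic n @[n --> \oo] --> alpha - 0.
    by apply: cvgB => //; exact: cvg_cst.
  by rewrite subr0.
- have : alpha + harmonic n @[n --> \oo] --> alpha + 0.
    by apply: cvgD => //; exact: cvg_cst.
  by rewrite addr0.
Qed.

(** * From a Farey neighbour to a convergent *)

Lemma is_convergent_floor alpha : is_convergent alpha (Num.floor alpha)%:~R.
Proof.
have [c [cc c0]] := cf_of_floor alpha; exists c; split=> //; exists 0%N => //.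
by case: c {cc c0}.
Qed.

Lemma is_convergent_step alpha (m : int) x : 0 < alpha - m%:~R < 1 ->
  is_convergent (alpha - m%:~R)^-1 x -> is_convergent alpha (m%:~R + x^-1).
Proof.
move=> am [c [cc [n cn ->]]].
have [c' [cc' _ /(_ n cn)[c'n <-]]] := cf_cons _ _ _ am cc.
by exists c'; split=> //; exists n.+1.
Qed.

(* c / d is a Farey neighbour of a / b, on the right if e = 1 and on the left if
   e = -1, and alpha is a / b or lies strictly between the two. *)
Definition between alpha (e a b c d : int) : Prop :=
  e * (c * b - a * d) = 1 /\
  (b%:~R * alpha = a%:~R \/
   0 < e%:~R * (b%:~R * alpha - a%:~R) /\ 0 < e%:~R * (c%:~R - d%:~R * alpha)).

(** The map alpha -> 1/(alpha - m) acts on pairs (numerator, denominator) by an integer matrix of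
    determinant -1, hence the change of sign of e; the inequalities are only multiplied by t > 0. *)
Lemma between_shift alpha (m e a b c d : int) : m%:~R < alpha ->
  between alpha e a b c d <->
  between (alpha - m%:~R)^-1 (- e) b (a - m * b) d (c - m * d).
Proof.
move=> am; set t := _^-1; have t0 : 0 < t by rewrite invr_gt0 subr_gt0.
have -> : alpha = m%:~R + t^-1 by rewrite invrK addrC subrK.
rewrite /between !rmorphB !rmorphM !rmorphN /=.
have tn : t != 0 by rewrite gt_eqF.
have -> : - e * (d * (a - m * b) - b * (c - m * d)) = e * (c * b - a * d).
  by ring.
set A : R := a%:~R; set B : R := b%:~R; set C : R := c%:~R; set D : R := d%:~R.
set M : R := m%:~R; set E : R := e%:~R.
have -> : - E * ((A - M * B) * t - B) = t * (E * (B * (M + t^-1) - A)) by field.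
have -> : - E * (D - (C - M * D) * t) = t * (E * (C - D * (M + t^-1))) by field.
rewrite !(pmulr_rgt0 _ t0).
have h : (A - M * B) * t - B = - t * (B * (M + t^-1) - A) by field.
have h' : (A - M * B) * t = B <-> B * (M + t^-1) = A.
  split=> [/eqP|].
    by rewrite -subr_eq0 h mulf_eq0 oppr_eq0 (negbTE tn) subr_eq0 => /eqP.
  by move=> h1; apply/eqP; rewrite -subr_eq0 h h1 subrr mulr0.
by split=> -[-> [/h'|]] => h1; split=> //; [left|right|left|right].
Qed.

Lemma sign_of_det (e k : int) : e * k = 1 -> e = 1 /\ k = 1 \/ e = -1 /\ k = -1.
Proof.
move=> ek; have /eqP : (`|e| * `|k|)%N = 1%N by rewrite -abszM ek.
by rewrite muln_eq1 => /andP[/eqP e1 /eqP k1]; nia.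
Qed.

(* The case b = d = 1 has to exclude e = -1: for alpha < a, the integer a is a
   convergent of alpha only if alpha > a - 1/2, as [a - 1; 1]. *)
Lemma is_convergent_between (n : nat) alpha (e a b c d : int) :
  b <= n%:Z -> 0 < b -> b < d \/ [/\ d = 1, b = 1 & e = 1] ->
  between alpha e a b c d -> is_convergent alpha (a%:~R / b%:~R).
Proof.
elim: n alpha e a b c d => [|n IH] alpha e a b c d bn b0.
  by move: (lt_le_trans b0 bn).
move=> bd bet; have [det aw] := bet.
have d_gt0 : 0 < d by case: bd => [|[->]]//; lia.
have dR : 1 <= d%:~R :> R by rewrite ler1z; lia.
have floorP (m : int) : m%:~R <= alpha < m%:~R + 1 -> Num.floor alpha = m.
  by rewrite -[1](_ : 1%:~R = _) // -intrD => /floor_def.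
have [b1|b1] := eqVneq b 1.
  rewrite {}b1 !mulr1z mulr1 mul1r divr1 in det aw bd b0 *.
  case: aw => [aE|[h1 h2]].
    have -> : a = Num.floor alpha by rewrite aE intrKfloor.
    exact: is_convergent_floor.
  (* If e = 1, then c/d = a + 1/d and a is the floor of alpha. If e = -1, then c/d = a - 1/d with d
     >= 2, so alpha lies above a - 1/2: its floor is a - 1 and the next term is 1. *)
  have [[e1 k1]|[e1 k1]] := sign_of_det _ _ det.
    have -> : a = Num.floor alpha.
      apply/esym/floorP; rewrite e1 mulr1z in h1 h2.
      have cE : c = a * d + 1 by lia.
      by move: h2; rewrite cE rmorphD rmorphM /= mulr1z; nra.
    exact: is_convergent_floor.
  have d2 : 1 < d by case: bd => // -[]; lia.
  have d2R : 2 <= d%:~R :> R by rewrite (_ : 2 = 2%:~R) // ler_int; lia.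
  rewrite e1 mulrN1z !mulN1r in h1 h2.
  have cE : c = a * d - 1 by lia.
  have am : 1 / 2 < alpha - (a - 1)%:~R < 1.
    move: h2; rewrite cE !rmorphB rmorphM /= mulr1z => h2.
    apply/andP; split; last lra.
    by nra.
  have -> : a%:~R = (a - 1)%:~R + 1^-1 :> rat by rewrite rmorphB /= invr1 subrK.
  apply: is_convergent_step; first lra.
  set t := _^-1; have -> : (1 : rat) = (Num.floor t)%:~R; last first.
    exact: is_convergent_floor.
  rewrite (_ : Num.floor t = 1) //; apply: floor_def.
  have [am1 am2] := andP am.
  have ap : 0 < alpha - (a - 1)%:~R by lra.
  have tb : t * (alpha - (a - 1)%:~R) = 1 by rewrite mulVf ?gt_eqF.
  by rewrite intrD mulr1z; nra.
have b2 : 1 < b by lia.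
have {}bd : b < d by case: bd => // -[_]; lia.
have bR : 0 < b%:~R :> R by rewrite ltr0z.
(* Euclidean step: with m the floor of a/b, the fractions become b/a' and d/c', and a' < b makes the
   induction progress. *)
pose m := (a %/ b)%Z; pose a' := a - m * b.
have a'E : a' = (a %% b)%Z by rewrite /a' {1}(divz_eq a b) addrC addKr.
have a'_ge0 : 0 <= a' by rewrite a'E modz_ge0 //; lia.
have a'_ltb : a' < b by rewrite a'E ltz_pmod.
have det' : e * ((c - m * d) * b - a' * d) = 1 by rewrite -det /a'; ring.
pose c' := c - m * d; rewrite -/c' in det'.
have a'_gt0 : 0 < a'.
  rewrite lt_neqAle a'_ge0 andbT; apply/eqP => a0; move: det'; rewrite -a0.
  by rewrite mul0r subr0 mulrA => /sign_of_det[[_ k1]|[_ k1]]; lia.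
have key : [/\ 0 < c', c' <= d & a' < c' \/ [/\ c' = 1, a' = 1 & - e = 1]].
  have [[e1 k1]|[e1 k1]] := sign_of_det _ _ det'.
    split; [nia|nia|left; nia].
  split; [nia|nia|].
  have [a1|a1] := eqVneq a' 1; last by left; nia.
  have [c1|c1] := eqVneq c' 1; first by right; rewrite e1.
  left; nia.
have [c'_gt0 c'd a'c'] := key.
(* a'/b lies in (0, 1) and c'/d in (0, 1]; alpha - m is the former or strictly between them. *)
have am : 0 < alpha - m%:~R < 1.
  have aE : a%:~R = a'%:~R + m%:~R * b%:~R :> R.
    by rewrite rmorphB rmorphM /= subrK.
  have cE : c%:~R = c'%:~R + m%:~R * d%:~R :> R.
    by rewrite rmorphB rmorphM /= subrK.
  have a'R : 0 < a'%:~R :> R by rewrite ltr0z.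
  have c'R : 0 < c'%:~R :> R by rewrite ltr0z.
  have a'bR : a'%:~R < b%:~R :> R by rewrite ltr_int.
  have c'dR : c'%:~R <= d%:~R :> R by rewrite ler_int.
  rewrite aE cE in aw; set beta := alpha - _.
  have abE : alpha = beta + m%:~R by rewrite subrK.
  rewrite abE in aw.
  case: aw => [h|[]]; first by nra.
  by have [[-> _]|[-> _]] := sign_of_det _ _ det';
    rewrite ?mulrN1z ?mulr1z => h1 h2;
    apply/andP; split; nra.
have -> : a%:~R / b%:~R = m%:~R + (b%:~R / a'%:~R)^-1 :> rat.
  have bQ : b%:~R != 0 :> rat by rewrite intr_eq0 gt_eqF.
  have a'Q : a'%:~R != 0 :> rat by rewrite intr_eq0 gt_eqF.
  have -> : a%:~R = a'%:~R + m%:~R * b%:~R :> rat.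
    by rewrite rmorphB rmorphM /= subrK.
  by field; apply/andP.
apply: is_convergent_step => //; apply: (IH _ (- e) b a' d c') => //.
  by clear - bn a'_ltb; lia.
have [m_lt _] := andP am; rewrite subr_gt0 in m_lt.
exact: (between_shift alpha m e a b c d m_lt).1 bet.
Qed.

(** * From a convergent to a Farey neighbour *)

Definition cf_head (c : cfrac) : int :=
  match c with CFfin b0 _ => b0 | CFinf b0 _ => b0 end.

Lemma cf_convergent0 c : cf_convergent c 0 = (cf_head c)%:~R.
Proof. by case: c => b0 s; rewrite /= /cf_eval ?take0 addr0. Qed.

Lemma cf_head_itv alpha c : cf_of alpha c ->
  (cf_head c)%:~R <= alpha < (cf_head c)%:~R + 1.
Proof.
case: c => [b0 [|b s]|b0 b] c.
- move: c => -[_ /=]; rewrite /cf_eval addr0 ratr_int => <-.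
  by rewrite lexx ltrDl ltr01.
- by have [/andP[h0 h1] _] := cf_fin_tail _ _ _ _ c; move: h0 h1 => /=; lra.
- by have [/andP[h0 h1] _] := cf_inf_tail _ _ _ c; move: h0 h1 => /=; lra.
Qed.

Lemma cf_tail alpha c n : cf_of alpha c -> cf_has_index c n.+1 ->
  (cf_head c)%:~R < alpha /\
  exists c', [/\ cf_of (alpha - (cf_head c)%:~R)^-1 c', cf_has_index c' n,
    0 < cf_head c' &
    cf_convergent c n.+1 = (cf_head c)%:~R + (cf_convergent c' n)^-1].
Proof.
case: c => [b0 [|b s]|b0 b] //= c; rewrite ?ltnS => ns.
- have [/andP[]] := cf_fin_tail _ _ _ _ c; rewrite subr_gt0 => h _ c'.
  split=> //; exists (CFfin b s); split=> //.
  by have [[/andP[]]] := c.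
- have [/andP[]] := cf_inf_tail _ _ _ c; rewrite subr_gt0 => h _ c'.
  split=> //; exists (CFinf (b 0%N) (b \o S)); split=> //.
    by have [/= b_pos _] := c; exact: b_pos.
  exact: cf_inf_convS.
Qed.

(* The neighbour [c / d] is the mediant of a convergent and its predecessor. *)
Lemma between_convergent alpha c n : cf_of alpha c -> cf_has_index c n ->
  exists e a b c' d : int, [/\ between alpha e a b c' d, 0 < b <= d,
    cf_convergent c n = a%:~R / b%:~R,
    0 < cf_head c -> 0 < a < c' & (0 < n)%N -> b < d].
Proof.
elim: n alpha c => [|n IH] alpha c cc cn.
  set m := cf_head c; have /andP[h1 h2] := cf_head_itv _ _ cc.
  rewrite -/m in h1 h2.
  (* The formal predecessor is 1/0, so the mediant is (m + 1)/1. Both denominators are 1, hence the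
     strict bound only for n > 0. *)
  exists 1, m, 1, (m + 1), 1; split=> //.
  - split; first by ring.
    rewrite rmorphD /= !mulr1z !mul1r.
    move: h1; rewrite le_eqVlt => /orP[/eqP|] h1.
      by left.
    by right; split; lra.
  - by rewrite cf_convergent0 divr1.
  - by move=> ->; lia.
have [h [c' [cc' c'n hc' ->]]] := cf_tail _ _ _ cc cn.
have [e [a [b [f [d [bet /andP[b0 bd] -> /(_ hc')/andP[a0 af] _]]]]]] :=
  IH _ _ cc' c'n.
set m := cf_head c in h *.
(* Images of the fractions of the tail under z -> m + 1/z. The new denominators are the old
   numerators, which is why the claim also orders numerators when the head is positive. *)
exists (- e), (b + m * a), a, (d + m * f), f; split=> //.
- apply/(between_shift _ m) => //.
  by rewrite opprK !addrK.
- by rewrite a0 ltW.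
- have aQ : a%:~R != 0 :> rat by rewrite intr_eq0 gt_eqF.
  have bQ : b%:~R != 0 :> rat by rewrite intr_eq0 gt_eqF.
  by rewrite rmorphD rmorphM /=; field; apply/andP.
- by move=> m0; apply/andP; split; nia.
Qed.

(** * Farey neighbours and approximation errors *)

(** Write (p, q) = k (a, b) + l (c, d). The errors u and v of the basis vectors have opposite
    directions, so that of (p, q) is |k u - l v|. As 0 < q <= b < d and l != 0, k and l have
    opposite signs, so this is |k| u + |l| v > u. *)
Lemma between_best alpha (e a b c d p q : int) : between alpha e a b c d ->
  0 < b < d -> 0 < q <= b -> p * b != a * q ->
  `|b%:~R * alpha - a%:~R| < `|q%:~R * alpha - p%:~R|.
Proof.
move=> [det aw] /andP[b0 bd] /andP[q0 qb] pq.
have bR : 0 < b%:~R :> R by rewrite ltr0z.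
case: aw => [h|[u0 v0]].
  rewrite h subrr normr0 normr_gt0 subr_eq0; apply: contra pq => /eqP qp.
  rewrite -(eqr_int R) !rmorphM /= -qp -h; apply/eqP; ring.
pose k := e * (c * q - d * p); pose l := e * (p * b - a * q).
have qE : q = k * b + l * d.
  by rewrite -[LHS]mulr1 -det /k /l; ring.
have pE : p = k * a + l * c.
  by rewrite -[LHS]mulr1 -det /k /l; ring.
have l0 : l != 0.
  rewrite /l mulf_neq0 ?subr_eq0 //; apply/eqP => e0.
  by move: det; rewrite e0 mul0r; lia.
have ee : e%:~R * e%:~R = 1 :> R.
  by have [[-> _]|[-> _]] := sign_of_det _ _ det; rewrite -?rmorphM.
have en : `|e%:~R| = 1 :> R.
  have [[-> _]|[-> _]] := sign_of_det _ _ det;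
    by rewrite ?mulrN1z ?normrN normr1.
set u := e%:~R * _ in u0; set v := e%:~R * _ in v0.
have -> : `|b%:~R * alpha - a%:~R| = u.
  by rewrite -(gtr0_norm u0) normrM en mul1r.
have -> : `|q%:~R * alpha - p%:~R| = `|k%:~R * u - l%:~R * v|.
  rewrite -[LHS]mul1r -[X in X * _]en -normrM qE pE !intrD !intrM /= /u /v.
  congr `| _ |; ring.
have [l_neg|l_pos] : l <= -1 \/ 1 <= l by lia.
  have k2 : 2 <= k by nia.
  have k2R : 2 <= k%:~R :> R by rewrite (_ : 2 = 2%:~R) // ler_int.
  have lR : l%:~R <= -1 :> R by rewrite (_ : -1 = (-1)%:~R) // ler_int.
  by apply: lt_le_trans (ler_norm _); nra.
have k2 : k <= -1 by nia.
have k2R : k%:~R <= -1 :> R by rewrite (_ : -1 = (-1)%:~R) // ler_int.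
have lR : 1 <= l%:~R :> R by rewrite ler1z.
by rewrite distrC; apply: lt_le_trans (ler_norm _); nra.
Qed.

(** Bezout coefficients solve the determinant equation, and subtracting a multiple of (a, b) reduces
    d modulo b. The remainder is not 0, because b > 1 does not divide 1. *)
Lemma exists_neighbour (e a b : int) : e * e = 1 -> 1 < b -> coprimez a b ->
  exists c d : int, 0 < d < b /\ e * (c * b - a * d) = 1.
Proof.
move=> ee b1 /coprimezP[[u v] /= uv].
pose k := ((- (e * u)) %/ b)%Z; exists (e * v - k * a), (- (e * u) %% b)%Z.
have dE : (- (e * u) %% b)%Z = - (e * u) - k * b.
  by rewrite {2}(divz_eq (- (e * u)) b) -/k; ring.
have det : e * ((e * v - k * a) * b - a * (- (e * u) %% b)%Z) = 1.
  by rewrite dE -[RHS]mulr1 -{1}ee -uv; ring.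
split=> //; rewrite ltz_pmod ?andbT; last lia.
rewrite lt_neqAle modz_ge0 ?andbT; last lia.
apply/eqP => d0; move: det; rewrite -d0 mulr0 subr0 mulrA.
by move=> /sign_of_det[[_ k1]|[_ k1]]; lia.
Qed.

Lemma num_den_frac (a b u v : int) : u * a + v * b = 1 -> 0 < b ->
  numq (a%:~R / b%:~R) = a /\ denq (a%:~R / b%:~R) = b.
Proof.
move=> uv b0; have cab : coprime `|a| `|b|.
  by apply/(coprimezP a b); exists (u, v).
rewrite coprimeq_num // coprimeq_den // gtr0_sg // mul1r.
by rewrite gt_eqF // gtr0_norm.
Qed.

(** * Ford circles and their tangent horocircles *)

Lemma ratrE x : ratr x = (numq x)%:~R / (denq x)%:~R :> R.
Proof. by []. Qed.

Lemma denqR_gt0 x : 0 < (denq x)%:~R :> R.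
Proof. by rewrite ltr0z denq_gt0. Qed.

Lemma second_kind_errE alpha x :
  second_kind_err alpha x = (denq x)%:~R * `|alpha - ratr x|.
Proof.
rewrite -[X in X * _]gtr0_norm ?denqR_gt0 // -normrM; congr `| _ |.
by rewrite ratrE; field; rewrite gt_eqF // denqR_gt0.
Qed.

Lemma horocircle_ford x : horocircle (@ford_circle R x) (ratr x).
Proof. exact/horocircleE. Qed.

(** For x = a/b the circle has radius r = 1/(2 b^2), so (alpha - x)^2 / (4 r) is (b alpha - a)^2 /
    2. The convention of radius 0 at alpha = x agrees with it. *)
Lemma tangent_horocircle_radius_ford alpha x :
  tangent_horocircle_radius alpha (ford_circle x) =
  second_kind_err alpha x ^+ 2 / 2.
Proof.
rewrite /tangent_horocircle_radius second_kind_errE.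
have [->|ne] := eqVneq alpha (ratr x).
  rewrite asboolT; last exact: horocircle_ford.
  by rewrite subrr normr0 mulr0 expr0n mul0r.
rewrite asboolF; last first.
  by move/horocircleE => -[/eqP]; rewrite eq_sym (negbTE ne).
rewrite (tangent_horocircle_unique (horocircle_ford x) ne).
set r := _ / _; rewrite (@xget_unique _ 0 [set r] r) // {}/r.
rewrite exprMn real_normK ?num_real //= /ford_radius.
by field; rewrite gt_eqF // denqR_gt0.
Qed.

Lemma ford_circle_inj : injective (@ford_circle R).
Proof. by move=> x y /(congr1 circle_centre)[/fmorph_inj]. Qed.

Lemma ford_rad_le x y :
  (circle_rad (@ford_circle R x) <= circle_rad (@ford_circle R y)) =
  (denq y <= denq x).
Proof.
rewrite /= /ford_radius lef_pV2 ?posrE ?mulr_gt0 ?exprn_gt0 ?denqR_gt0 //.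
by rewrite ler_pM2l // ler_pXn2r ?ler_int // nnegrE ltW // denqR_gt0.
Qed.

(** Tangency means that the squared distance of the base points is 4 r s. For denominators b and d
    this is 1/(b d)^2, while the distance is the absolute determinant over b d. *)
Lemma tangent_ford x y : x != y ->
  tangent (@ford_circle R y) (ford_circle x) <->
  numq y * denq x - numq x * denq y = 1 \/
  numq y * denq x - numq x * denq y = -1.
Proof.
move=> xy.
have xyR : ratr y != ratr x :> R by rewrite fmorph_eq eq_sym.
rewrite (tangent_horocirclesE (horocircle_ford y) (horocircle_ford x) xyR).
rewrite /= /ford_radius !ratrE.
set k := numq y * _ - _ in |- *.
have kE : k%:~R =
    (numq y)%:~R * (denq x)%:~R - (numq x)%:~R * (denq y)%:~R :> R.
  by rewrite rmorphB !rmorphM.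
have x0 := denqR_gt0 x; have y0 := denqR_gt0 y.
have -> : ((numq y)%:~R / (denq y)%:~R - (numq x)%:~R / (denq x)%:~R) ^+ 2 =
    (k%:~R / ((denq x)%:~R * (denq y)%:~R)) ^+ 2 :> R.
  by congr (_ ^+ 2); rewrite kE; field; rewrite !gt_eqF.
have -> : 4 * (2 * (denq y)%:~R ^+ 2)^-1 * (2 * (denq x)%:~R ^+ 2)^-1 =
    (1 / ((denq x)%:~R * (denq y)%:~R)) ^+ 2 :> R.
  by field; rewrite !gt_eqF.
have d0 : ((denq x)%:~R * (denq y)%:~R) ^+ 2 != 0 :> R.
  by rewrite !mulf_neq0 ?gt_eqF.
rewrite !expr_div_n; split=> [/(mulIf (invr_neq0 d0)) /eqP|[]->]; last first.
- by rewrite rmorphN /= rmorph1 sqrrN.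
- by rewrite rmorph1.
rewrite expr1n sqrf_eq1 -[1](_ : 1%:~R = _) // -mulrNz !eqr_int.
by case/orP => /eqP; [left|right].
Qed.

Lemma nearby_best_approx2 alpha x : best_approx2 alpha x -> nearby x alpha.
Proof.
move=> best z zx; rewrite ford_rad_le => /best[le_xz eq_xz].
rewrite !tangent_horocircle_radius_ford ltr_pM2r ?invr_gt0 //.
rewrite ltr_pXn2r ?nnegrE ?normr_ge0 // lt_neqAle le_xz andbT.
by apply/eqP => /eq_xz zE; apply: zx; rewrite zE.
Qed.

Lemma nearby_err_lt x alpha y : nearby x alpha -> y != x -> denq y <= denq x ->
  second_kind_err alpha x < second_kind_err alpha y.
Proof.
move=> near yx yle; have : ford_circle y <> @ford_circle R x.
  by move=> /ford_circle_inj/eqP; rewrite (negbTE yx).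
move=> /near; rewrite ford_rad_le => /(_ yle).
rewrite !tangent_horocircle_radius_ford ltr_pM2r ?invr_gt0 //.
by rewrite ltr_pXn2r ?nnegrE ?normr_ge0.
Qed.

(** * The equivalences *)

(** Integer form of the condition on tangent circles: the larger denominator d stands for the
    smaller circle. *)
Definition has_outer_neighbour alpha x : Prop := exists e c d : int,
  denq x < d /\ between alpha e (numq x) (denq x) c d.

Lemma outer_neighbour_convergent alpha x : has_outer_neighbour alpha x ->
  is_convergent alpha x.
Proof.
move=> [e [c [d [xd bet]]]]; rewrite -[x]divq_num_den.
apply: (is_convergent_between `|denq x|%N _ _ _ _ _ _ _ _ _ bet) => //;
  last by left.
by rewrite gez0_abs // ltW.
Qed.

Lemma convergent_outer_neighbour alpha x : x \isn't a Num.int ->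
  is_convergent alpha x -> has_outer_neighbour alpha x.
Proof.
move=> xi [c [cc [n cn xE]]].
(* A positive index is what makes the neighbour's denominator strictly larger. *)
have n0 : (0 < n)%N.
  rewrite lt0n; apply: contraNneq xi => n0.
  by rewrite xE n0 cf_convergent0 intr_int.
have [e [a [b [f [d [bet /andP[b0 bd] cE _ /(_ n0) blt]]]]]] :=
  between_convergent _ _ _ cc cn.
have [det _] := bet.
have [|nE dE] := num_den_frac a b (- (e * d)) (e * f) _ b0.
  by rewrite -[RHS]det; ring.
by exists e, f, d; rewrite xE cE nE dE.
Qed.

Lemma outer_neighbour_best_approx2 alpha x : has_outer_neighbour alpha x ->
  best_approx2 alpha x.
Proof.
move=> [e [c [d [xd bet]]]] y yx.
have [->|ne] := eqVneq y x; first by [].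
have lt : second_kind_err alpha x < second_kind_err alpha y.
  apply: (between_best _ _ _ _ _ _ _ _ bet); rewrite ?denq_gt0 ?xd ?yx //.
  apply: contra ne => /eqP h; rewrite -[y]divq_num_den -[x]divq_num_den.
  by rewrite eqr_div ?intr_eq0 ?denq_neq0 // -!intrM h.
split; first exact: ltW.
split=> [h|/eqP]; first by move: lt; rewrite h ltxx.
by rewrite (negbTE ne).
Qed.

(** x beats its neighbour c/d of smaller denominator on the side of alpha. The two errors balance at
    the mediant (a + c)/(b + d), so alpha lies before it, and the mediant is the required
    neighbour. *)
Lemma nearby_outer_neighbour alpha x : x \isn't a Num.int ->
  nearby x alpha -> has_outer_neighbour alpha x.
Proof.
move=> xi near; set a := numq x; set b := denq x.
have b0 : 0 < b := denq_gt0 x.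
have b1 : 1 < b.
  have : b != 1; last by lia.
  apply: contraNneq xi => b1; rewrite -[x]divq_num_den -/b b1 divr1.
  exact: intr_int.
have cab : coprimez a b := coprime_num_den x.
(* If alpha = x, either side will do. *)
have [xa|xa] := eqVneq (b%:~R * alpha) a%:~R.
  have [c [d [/andP[d0 db] det]]] := exists_neighbour 1 a b erefl b1 cab.
  exists 1, (a + c), (b + d); split; first by rewrite ltrDl.
  by split; [rewrite -[RHS]det; ring|left].
have [e ee u0] : exists2 e : int, e * e = 1 &
    0 < e%:~R * (b%:~R * alpha - a%:~R) :> R.
  have [h|h|h] := ltgtP (b%:~R * alpha) a%:~R.
  - by exists (-1) => //; rewrite mulrN1z mulN1r oppr_gt0 subr_lt0.
  - by exists 1 => //; rewrite mul1r subr_gt0.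
  - by rewrite h eqxx in xa.
have [c [d [/andP[d0 db] det]]] := exists_neighbour e a b ee b1 cab.
have [|nE dE] := num_den_frac c d (e * b) (- (e * a)) _ d0.
  by rewrite -[RHS]det; ring.
have en : `|e%:~R| = 1 :> R.
  have [[-> _]|[-> _]] := sign_of_det _ _ det;
    by rewrite ?mulrN1z ?normrN normr1.
exists e, (a + c), (b + d); split; first by rewrite ltrDl.
split; first by rewrite -[RHS]det; ring.
right; split=> //.
have := nearby_err_lt _ _ (c%:~R / d%:~R) near.
rewrite dE /second_kind_err nE dE -/a -/b => /(_ _ (ltW db)) lt.
have {}lt : `|b%:~R * alpha - a%:~R| < `|d%:~R * alpha - c%:~R|.
  by apply: lt; apply: contraTneq db => h; rewrite /b -h dE ltxx.
have detR : e%:~R * (c%:~R * b%:~R - a%:~R * d%:~R) = 1 :> R.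
  by rewrite -!intrM -intrB -intrM det.
have normE (z : R) : `|z| = `|e%:~R * z| by rewrite normrM en mul1r.
rewrite (normE (_ - a%:~R)) (normE (_ - c%:~R)) (gtr0_norm u0) in lt.
have d1R : 0 < d%:~R :> R by rewrite ltr0z.
have b1R : 0 < b%:~R :> R by rewrite ltr0z.
have dbR : d%:~R < b%:~R :> R by rewrite ltr_int.
rewrite !rmorphD /=.
set E : R := e%:~R in detR u0 lt *; set A : R := a%:~R in detR u0 lt *.
set B : R := b%:~R in detR u0 lt b1R dbR *.
set C : R := c%:~R in detR lt *; set D : R := d%:~R in detR lt d1R dbR *.
(* If alpha has not reached c/d, the comparison of errors is the goal. Otherwise the combination
   below is positive, yet alpha cancels in it and leaves minus the determinant, -1. *)
have [w0|w0] := leP 0 (E * (D * alpha - C)); last first.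
  rewrite ltr0_norm // in lt; lra.
rewrite ger0_norm // in lt.
exfalso.
have s1 : 0 < E * ((D - B) * alpha - (C - A)) by lra.
have : 0 < (B - D) * (E * (B * alpha - A))
    + B * (E * ((D - B) * alpha - (C - A))).
  by rewrite addr_gt0 // mulr_gt0 // subr_gt0.
have -> : (B - D) * (E * (B * alpha - A))
    + B * (E * ((D - B) * alpha - (C - A))) = - (E * (C * B - A * D)) by ring.
by rewrite detR; lra.
Qed.

Lemma outer_neighbour_tangent alpha x : has_outer_neighbour alpha x <->
  exists y : rat,
    [/\ tangent (@ford_circle R y) (ford_circle x),
        circle_rad (@ford_circle R y) < circle_rad (@ford_circle R x)
      & alpha = ratr x \/
        Num.min (ratr x) (ratr y) < alpha < Num.max (ratr x) (ratr y)].
Proof.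
have x0 : 0 < (denq x)%:~R :> R := denqR_gt0 x.
have side y : alpha < ratr y <-> (denq y)%:~R * alpha < (numq y)%:~R.
  by rewrite ratrE ltr_pdivlMr ?denqR_gt0 // mulrC.
have side' y : ratr y < alpha <-> (numq y)%:~R < (denq y)%:~R * alpha.
  by rewrite ratrE ltr_pdivrMr ?denqR_gt0 // mulrC.
have ax : alpha = ratr x <-> (denq x)%:~R * alpha = (numq x)%:~R.
  rewrite ratrE; split=> [->|<-]; first by rewrite mulrC divfK ?gt_eqF.
  by rewrite [_ * alpha]mulrC mulfK ?gt_eqF.
split=> [[e [c [d [xd [det aw]]]]]|[y [tan rad aw]]].
  have d0 : 0 < d by rewrite (lt_trans _ xd) ?denq_gt0.
  have [|nE dE] := num_den_frac c d (e * denq x) (- (e * numq x)) _ d0.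
    by rewrite -[RHS]det; ring.
  set y := c%:~R / d%:~R in nE dE; exists y.
  have xy : x != y by apply: contraTneq xd => ->; rewrite dE ltxx.
  split.
  - apply/(tangent_ford _ _ xy); rewrite nE dE.
    by have [[_ ->]|[_ ->]] := sign_of_det _ _ det; [left|right].
  - by rewrite ltNge ford_rad_le -ltNge dE.
  - case: aw => [h|[h1 h2]]; [by left; apply/ax|right].
    have [[e1 _]|[e1 _]] := sign_of_det _ _ det;
      rewrite e1 ?mulr1z ?mulrN1z ?mul1r ?mulN1r ?oppr_gt0 ?subr_gt0
        ?subr_lt0 in h1 h2.
    + move: h1 h2; rewrite -nE -dE => /side' h1 /side h2.
      by rewrite gt_min h1 lt_max h2 orbT.
    + move: h1 h2; rewrite -nE -dE => /side h1 /side' h2.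
      by rewrite gt_min h2 lt_max h1 orbT.
have xy : x != y by apply: contraTneq rad => ->; rewrite ltxx.
have xd : denq x < denq y by move: rad; rewrite ltNge ford_rad_le -ltNge.
(* e is the determinant itself, which is its own inverse. *)
have [e det] : exists e : int, e * (numq y * denq x - numq x * denq y) = 1.
  by have [->|->] := (tangent_ford _ _ xy).1 tan; [exists 1|exists (-1)].
exists e, (numq y), (denq y); split=> //; split=> //.
case: aw => [/ax h|aw]; [by left|right].
(* y - x has the sign of the determinant, so e tells which end is the minimum. *)
have yx : ratr y - ratr x = (numq y * denq x - numq x * denq y)%:~R
    / ((denq x)%:~R * (denq y)%:~R) :> R.
  rewrite intrB !intrM !ratrE; field.
  by rewrite !gt_eqF // denqR_gt0.
have xyd : 0 < ((denq x)%:~R * (denq y)%:~R)^-1 :> R.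
  by rewrite invr_gt0 mulr_gt0 // denqR_gt0.
have [[e1 k1]|[e1 k1]] := sign_of_det _ _ det; rewrite k1 in yx; rewrite e1.
- rewrite mulr1z mul1r in yx; have lt : ratr x < ratr y :> R by lra.
  rewrite (min_l (ltW lt)) (max_r (ltW lt)) in aw.
  by move/andP: aw => [/side' h1 /side h2]; rewrite mulr1z !mul1r !subr_gt0.
- rewrite mulrN1z mulN1r in yx; have lt : ratr y < ratr x :> R by lra.
  rewrite (min_r (ltW lt)) (max_l (ltW lt)) in aw.
  move/andP: aw => [/side' h1 /side h2].
  by rewrite mulrN1z !mulN1r !oppr_gt0 !subr_lt0.
Qed.

End FordCircles.

Theorem theorem2 (R : realType) (alpha : R) (x : rat)
    (hx : x \isn't a Num.int) :
  [<-> is_convergent alpha x;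
       in_cf_chain alpha (ford_circle x);
       best_approx2 alpha x;
       nearby x alpha;
       exists y : rat,
         [/\ tangent (@ford_circle R y) (ford_circle x),
             circle_rad (@ford_circle R y) < circle_rad (@ford_circle R x)
           & alpha = ratr x \/
             Num.min (ratr x) (ratr y) < alpha < Num.max (ratr x) (ratr y)]].
Proof.
tfae.
- by move=> [c [cc [n cn ->]]]; exists c; split=> //; exists n.
(* A Ford circle determines its rational, so x is itself a convergent. *)
- move=> [c [cc [n cn /ford_circle_inj xE]]].
  apply/outer_neighbour_best_approx2/convergent_outer_neighbour => //.
  by exists c; split=> //; exists n.
- exact: nearby_best_approx2.
- by move=> /(nearby_outer_neighbour _ _ hx)/outer_neighbour_tangent.
- by move=> /outer_neighbour_tangent/outer_neighbour_convergent.
Qed.
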